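(* $\mathrm{SL}(2,\mathbb{Q})$ only has finite order automorphisms of orders $1$, $2$, $3$, $4$ and $6$. Further, $C(2,\mathbb{Q})$ is infinite, and $C(3,\mathbb{Q}) = C(4,\mathbb{Q}) = C(6,\mathbb{Q}) = 1$.
   Context: For an invertible $2\times 2$ matrix $A$, $\operatorname{Inn}_A$ denotes the map $X \mapsto A^{-1}XA$. An automorphism of $\mathrm{SL}(2,\mathbb{Q})$ means an automorphism of the algebraic group $\mathrm{SL}_2$ (equivalently of $\mathrm{SL}(2,\overline{\mathbb{Q}})$ as an algebraic group) which leaves $\mathrm{SL}(2,\mathbb{Q})$ invariant. Two automorphisms $\theta,\tau$ of $\mathrm{SL}(2,\mathbb{Q})$ are isomorphic (over $\mathrm{GL}(2,\mathbb{Q})$) if there is $Q \in \mathrm{GL}(2,\mathbb{Q})$ such that $\tau = \operatorname{Inn}_Q^{-1}\,\theta\,\operatorname{Inn}_Q$; the equivalence classes are called isomorphy classes. $C(m,\mathbb{Q})$ denotes the number of isomorphy classes of automorphisms of $\mathrm{SL}(2,\mathbb{Q})$ of order (exactly) $m$. *)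

(* Defs.v *)
(* algC is taken as the algebraic closure of Q. *)
From HB Require Import structures.
From mathcomp Require Import all_boot all_order all_algebra all_field.
From mathcomp Require Import classical_sets functions cardinality.
From mathcomp Require Import mpoly.

Set Implicit Arguments.
Unset Strict Implicit.
Unset Printing Implicit Defensive.

Import GRing.Theory.
Local Open Scope ring_scope.

Record GL2 (F : fieldType) := MkGL2 {
  gl2_mx :> 'M[F]_2;
  gl2_unit : gl2_mx \in unitmx
}.

HB.instance Definition _ (F : fieldType) := [isSub for @gl2_mx F].
HB.instance Definition _ (F : fieldType) := [Choice of GL2 F by <:].

Record SL2 (F : fieldType) := MkSL2 {
  sl2_mx :> 'M[F]_2;
  sl2_det : \det sl2_mx == 1
}.

HB.instance Definition _ (F : fieldType) := [isSub for @sl2_mx F].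
HB.instance Definition _ (F : fieldType) := [Choice of SL2 F by <:].

Section GroupGL2.
Variable F : fieldType.
Implicit Types A B C : GL2 F.

Fact gl2_mul_subproof A B : (A : 'M_2) *m B \in unitmx.
Proof. by rewrite unitmx_mul !gl2_unit. Qed.

Fact gl2_one_subproof : (1%:M : 'M[F]_2) \in unitmx.
Proof. exact: unitmx1. Qed.

Fact gl2_inv_subproof A : invmx A \in unitmx.
Proof. by rewrite unitmx_inv gl2_unit. Qed.

Definition gl2_mul A B := MkGL2 (gl2_mul_subproof A B).
Definition gl2_one := MkGL2 gl2_one_subproof.
Definition gl2_inv A := MkGL2 (gl2_inv_subproof A).

Fact gl2_mulA : associative gl2_mul.
Proof. by move=> A B C; apply: val_inj; rewrite /= mulmxA. Qed.

Fact gl2_mul1 : left_id gl2_one gl2_mul.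
Proof. by move=> A; apply: val_inj; rewrite /= mul1mx. Qed.

Fact gl2_mulr1 : right_id gl2_one gl2_mul.
Proof. by move=> A; apply: val_inj; rewrite /= mulmx1. Qed.

Fact gl2_mulV : left_inverse gl2_one gl2_inv gl2_mul.
Proof. by move=> A; apply: val_inj; rewrite /= mulVmx ?gl2_unit. Qed.

Fact gl2_mulrV : right_inverse gl2_one gl2_inv gl2_mul.
Proof. by move=> A; apply: val_inj; rewrite /= mulmxV ?gl2_unit. Qed.

HB.instance Definition _ := isGroup.Build (GL2 F)
  gl2_mulA gl2_mul1 gl2_mulr1 gl2_mulV gl2_mulrV.

End GroupGL2.

Section GroupSL2.
Variable F : fieldType.
Implicit Types X Y Z : SL2 F.

Fact sl2_unit X : (X : 'M_2) \in unitmx.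
Proof. by rewrite unitmxE (eqP (sl2_det X)) unitr1. Qed.

Fact sl2_mul_subproof X Y : \det ((X : 'M_2) *m Y) == 1.
Proof. by rewrite det_mulmx (eqP (sl2_det X)) (eqP (sl2_det Y)) mul1r. Qed.

Fact sl2_one_subproof : \det (1%:M : 'M[F]_2) == 1.
Proof. by rewrite det1. Qed.

Fact sl2_inv_subproof X : \det (invmx X) == 1.
Proof. by rewrite det_inv (eqP (sl2_det X)) invr1. Qed.

Definition sl2_mul X Y := MkSL2 (sl2_mul_subproof X Y).
Definition sl2_one := MkSL2 sl2_one_subproof.
Definition sl2_inv X := MkSL2 (sl2_inv_subproof X).

Fact sl2_mulA : associative sl2_mul.
Proof. by move=> X Y Z; apply: val_inj; rewrite /= mulmxA. Qed.

Fact sl2_mul1 : left_id sl2_one sl2_mul.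
Proof. by move=> X; apply: val_inj; rewrite /= mul1mx. Qed.

Fact sl2_mulr1 : right_id sl2_one sl2_mul.
Proof. by move=> X; apply: val_inj; rewrite /= mulmx1. Qed.

Fact sl2_mulV : left_inverse sl2_one sl2_inv sl2_mul.
Proof. by move=> X; apply: val_inj; rewrite /= mulVmx ?sl2_unit. Qed.

Fact sl2_mulrV : right_inverse sl2_one sl2_inv sl2_mul.
Proof. by move=> X; apply: val_inj; rewrite /= mulmxV ?sl2_unit. Qed.

HB.instance Definition _ := isGroup.Build (SL2 F)
  sl2_mulA sl2_mul1 sl2_mulr1 sl2_mulV sl2_mulrV.

Fact Inn_subproof (A : GL2 F) X : \det (invmx A *m X *m A) == 1.
Proof.
rewrite !det_mulmx det_inv mulrAC mulVr ?mul1r ?sl2_det //.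
by rewrite -unitmxE gl2_unit.
Qed.

Definition Inn (A : GL2 F) X : SL2 F := MkSL2 (Inn_subproof A X).

Lemma InnK (A : GL2 F) : cancel (Inn A) (Inn A^-1%g).
Proof.
move=> X; apply: val_inj; rewrite /= invmxK !mulmxA mulmxV ?gl2_unit //.
by rewrite mul1mx -mulmxA mulmxV ?gl2_unit // mulmx1.
Qed.

Lemma InnVK (A : GL2 F) : cancel (Inn A^-1%g) (Inn A).
Proof.
move=> X; apply: val_inj; rewrite /= invmxK !mulmxA mulVmx ?gl2_unit //.
by rewrite mul1mx -mulmxA mulVmx ?gl2_unit // mulmx1.
Qed.

End GroupSL2.

Fact gl2_ratr_subproof (Q : GL2 rat) :
  map_mx (ratr : rat -> algC) Q \in unitmx.
Proof. by rewrite map_unitmx gl2_unit. Qed.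

Definition gl2_ratr (Q : GL2 rat) : GL2 algC := MkGL2 (gl2_ratr_subproof Q).

Fact sl2_ratr_subproof (X : SL2 rat) :
  \det (map_mx (ratr : rat -> algC) X) == 1.
Proof. by rewrite det_map_mx (eqP (sl2_det X)) rmorph1. Qed.

Definition sl2_ratr (X : SL2 rat) : SL2 algC := MkSL2 (sl2_ratr_subproof X).

Definition SL2Q : set (SL2 algC) := range sl2_ratr.

(* The regular functions on the closed subset SL_2 of affine 4-space are the
   restrictions of polynomials in the 4 matrix entries. *)
Definition regular_morphism (f : SL2 algC -> SL2 algC) : Prop :=
  exists P : 'M[{mpoly algC[2 * 2]}]_2,
    forall (X : SL2 algC) (i j : 'I_2),
      f X i j = (P i j).@[fun k => mxvec X 0 k].

Definition algebraic_group_automorphism (f : SL2 algC -> SL2 algC) : Prop :=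
  [/\ {morph f : X Y / (X * Y)%g}, regular_morphism f &
      exists g : SL2 algC -> SL2 algC,
        [/\ cancel f g, cancel g f & regular_morphism g]].

Definition SL2Q_automorphism (theta : SL2 algC -> SL2 algC) : Prop :=
  algebraic_group_automorphism theta /\ (theta @` SL2Q = SL2Q)%classic.

Definition has_order (m : nat) (theta : SL2 algC -> SL2 algC) : Prop :=
  [/\ (0 < m)%N, iter m theta =1 id &
      forall k : nat, (0 < k < m)%N -> ~ iter k theta =1 id].

(* By InnK and InnVK, Inn A^-1 is the inverse map of Inn A. *)
Definition isomorphic_over_GL2Q (theta tau : SL2 algC -> SL2 algC) : Prop :=
  exists Q : GL2 rat,
    tau = Inn (gl2_ratr Q)^-1%g \o theta \o Inn (gl2_ratr Q).

Definition isomorphy_class (theta : SL2 algC -> SL2 algC) :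
    set (SL2 algC -> SL2 algC) :=
  [set tau | SL2Q_automorphism tau /\ isomorphic_over_GL2Q theta tau]%classic.

(* C(m, Q) is the cardinality of this set. *)
Definition isomorphy_classes (m : nat) :
    set (set (SL2 algC -> SL2 algC)) :=
  [set isomorphy_class theta | theta in
    [set theta | SL2Q_automorphism theta /\ has_order m theta]]%classic.

(* Main.v *)
(* The image of the one-parameter group u(t) of upper unitriangular matrices under
   an algebraic automorphism f is polynomial in t. Since tr(A^2) = tr(A)^2 - 2 on
   SL_2, its trace is constant, so f(u(t)) = 1 + t N with N^2 = 0; likewise for the
   lower unitriangular matrices, with some M. The braid relation
   u(1) l(-1) u(1) = l(-1) u(1) l(-1) forces tr(M N) = 1, whence N and M are
   conjugate, simultaneously and over Q when f preserves SL(2, Q), to E_12 and E_21: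
   thus f = Inn_A with A in GL(2, Q). Now Inn_A has order m iff m is minimal with A^m
   scalar, and then, for A not scalar, the eigenvalue ratio z is a root of unity,
   tr(A)^2 / det(A) = z + 1/z + 2 is an integer in [0, 3], and the values 0, 1, 2, 3
   correspond to the orders 2, 3, 4, 6. The value r = 1, 2, 3 determines A up to
   scaling and conjugation; in trace 0 the square class of det(A) is an invariant,
   and it takes infinitely many values. *)
Require Import Defs.
From HB Require Import structures.
From mathcomp Require Import all_boot all_order all_algebra all_field.
From mathcomp Require Import boolp classical_sets functions cardinality.
From mathcomp Require Import mpoly ring zify.

Section Automorphisms.
Set Implicit Arguments.
Unset Strict Implicit.
Unset Printing Implicit Defensive.

Import Order.TTheory GRing.Theory Num.Theory.
Local Open Scope ring_scope.

(** * Entrywise computation with two-by-two matrices *)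

Lemma ord2P (P : 'I_2 -> Prop) : P 0 -> P 1 -> forall i, P i.
Proof.
move=> P0 P1 [[|[|k]] lt_k2] //; first by congr P: P0; apply: val_inj.
by congr P: P1; apply: val_inj.
Qed.

Lemma eq_mx2 (R : Type) (A B : 'M[R]_2) :
  A 0 0 = B 0 0 -> A 0 1 = B 0 1 -> A 1 0 = B 1 0 -> A 1 1 = B 1 1 -> A = B.
Proof. by move=> *; apply/matrixP; apply: ord2P; apply: ord2P. Qed.

Lemma big_ord2 (V : nmodType) (F : 'I_2 -> V) : \sum_i F i = F 0 + F 1.
Proof.
by rewrite big_ord_recl big_ord1; congr (_ + F _); apply: val_inj.
Qed.

Section TwoByTwo.
Variable R : comNzRingType.
Implicit Types (A B : 'M[R]_2) (a b c d t : R).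

Lemma mulmx2E A B i j : (A *m B) i j = A i 0 * B 0 j + A i 1 * B 1 j.
Proof. by rewrite mxE big_ord2. Qed.

Lemma mxtrace2 A : \tr A = A 0 0 + A 1 1.
Proof. by rewrite /mxtrace big_ord2. Qed.

Lemma det_mx2 A : \det A = A 0 0 * A 1 1 - A 0 1 * A 1 0.
Proof.
rewrite (expand_det_row _ 0) big_ord2 /cofactor !det_mx11 !mxE /=.
rewrite expr0 mul1r expr1 mulN1r mulrN.
by congr (_ * A _ _ - _ * A _ _); apply: val_inj.
Qed.

Definition mx2 a b c d : 'M[R]_2 :=
  \matrix_(i, j) if i == 0 then if j == 0 then a else b
                 else if j == 0 then c else d.

Definition mx2E := (mulmx2E, mxtrace2, det_mx2, mxE).

Lemma cayley_hamilton2 A : A *m A = \tr A *: A - (\det A)%:M.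
Proof. by apply: eq_mx2; rewrite !mx2E /=; ring. Qed.

Definition upper t : 'M[R]_2 := mx2 1 t 0 1.
Definition lower t : 'M[R]_2 := mx2 1 0 t 1.

End TwoByTwo.

(** * Unitriangular matrices and the generation of [SL_2] *)

Lemma upper_subproof (F : fieldType) (t : F) : \det (upper t) == 1.
Proof. by apply/eqP; rewrite !mx2E /=; ring. Qed.

Lemma lower_subproof (F : fieldType) (t : F) : \det (lower t) == 1.
Proof. by apply/eqP; rewrite !mx2E /=; ring. Qed.

Definition sl2_upper (F : fieldType) (t : F) := MkSL2 (upper_subproof t).
Definition sl2_lower (F : fieldType) (t : F) := MkSL2 (lower_subproof t).

Section Elementary.
Variable F : fieldType.
Implicit Types s t : F.

Lemma sl2_upperD s t : sl2_upper (s + t) = (sl2_upper s * sl2_upper t)%g.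
Proof. by apply: val_inj; apply: eq_mx2; rewrite !mx2E /=; ring. Qed.

Lemma sl2_lowerD s t : sl2_lower (s + t) = (sl2_lower s * sl2_lower t)%g.
Proof. by apply: val_inj; apply: eq_mx2; rewrite !mx2E /=; ring. Qed.

Lemma sl2_braid : (sl2_upper 1 * sl2_lower (-1) * sl2_upper 1)%g =
  (sl2_lower (-1) * sl2_upper 1 * sl2_lower (-1))%g :> SL2 F.
Proof. by apply: val_inj; apply: eq_mx2; rewrite !mx2E /=; ring. Qed.

(** A matrix with rows [(a, b)], [(c, d)] and [c != 0] equals [u((a-1)/c) l(c) u((d-1)/c)], and the
    case [c = 0] reduces to this one. Hence an endomorphism is determined by its values on
    unitriangular matrices. *)
Lemma SL2_elementary_ind (P : SL2 F -> Prop) :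
    (forall X Y, P X -> P Y -> P (X * Y)%g) ->
    (forall t, P (sl2_upper t)) -> (forall t, P (sl2_lower t)) ->
  forall X, P X.
Proof.
move=> PM PU PL; have Pnz (X : SL2 F) : X 1 0 != 0 -> P X.
  move=> nz; have /eqP := sl2_det X; rewrite det_mx2 => dX.
  suff -> : X = (sl2_upper ((X 0 0 - 1) / X 1 0)%R * sl2_lower (X 1 0)%R *
                 sl2_upper ((X 1 1 - 1) / X 1 0)%R)%g by apply/PM => //; apply/PM.
  apply: val_inj; apply: eq_mx2; rewrite !mx2E /=; try by field.
  have -> : X 0 1 = (X 0 0 * X 1 1 - 1) / X 1 0 by rewrite -dX; field.
  by field.
move=> X; have [z|/Pnz//] := eqVneq (X 1 0) 0.
have -> : X = (X * sl2_lower 1 * sl2_lower (-1))%g.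
  by rewrite -mulgA -sl2_lowerD; apply: val_inj; apply: eq_mx2; rewrite !mx2E /=; ring.
(* When [X 1 0 = 0], the lower left entry of [X l(1)] is [X 1 1], which is nonzero because the
   determinant is 1. *)
apply: (PM) => //; apply: Pnz; rewrite !mx2E /= z mul0r add0r mulr1.
apply/eqP => z1; have /eqP := sl2_det X.
by rewrite det_mx2 z z1 !mulr0 subrr => /eqP; rewrite eq_sym oner_eq0.
Qed.

End Elementary.

(** * Polynomial one-parameter groups *)

Lemma meval_line (R : comNzRingType) n (p : {mpoly R[n]}) (v w : 'I_n -> R) :
  exists q : {poly R}, forall t, p.@[fun k => v k + w k * t] = q.[t].
Proof.
(* Each variable is replaced by the linear polynomial that parametrizes its coordinate on the
   line. *)
exists (\sum_(m <- msupp p) p@_m *: \prod_i ((v i)%:P + w i *: 'X) ^+ m i) => t.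
rewrite mevalE horner_sum; apply: eq_bigr => m _.
rewrite hornerZ horner_prod; congr (_ * _); apply: eq_bigr => i _.
by rewrite !hornerE.
Qed.

(** In characteristic zero the first [size p] natural numbers are distinct, too many roots for a
    nonzero [p]. Polynomial identities can thus be checked on natural numbers, where induction is
    available. *)
Lemma poly_natr_eq0 (K : numDomainType) (p : {poly K}) :
  (forall n : nat, p.[n%:R] = 0) -> p = 0.
Proof.
move=> p0; apply/eqP; apply: contraT => nz.
have := max_poly_roots (rs := [seq n%:R | n <- iota 0 (size p)]) nz.
rewrite size_map size_iota ltnn map_inj_uniq ?iota_uniq;
  last exact: mulrIn (oner_neq0 _).
by move=> -> //; apply/allP=> _ /mapP[n _ ->]; apply/eqP/p0.
Qed.

(* The trace T satisfies T(2t) = T(t)^2 - 2, whence deg T = 2 deg T. *)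
Lemma trace_polynomial_group (K : numFieldType) (g : K -> 'M[K]_2)
    (p : 'M[{poly K}]_2) :
    (forall t i j, g t i j = (p i j).[t]) ->
    (forall s t, g (s + t) = g s *m g t) -> (forall t, \det (g t) = 1) ->
  forall t, \tr (g t) = 2.
Proof.
move=> gE gD dg; have [T TE] : exists T : {poly K}, forall t, T.[t] = \tr (g t).
  by exists (p 0 0 + p 1 1) => t; rewrite mxtrace2 !gE hornerD.
have TD : T \Po (2%:P * 'X) = T ^+ 2 - 2%:P.
  apply/subr0_eq/poly_natr_eq0 => n; rewrite !(hornerE, horner_comp) !TE.
  have -> : 2 * n%:R = n%:R + n%:R :> K by ring.
  by rewrite gD cayley_hamilton2 linearB linearZ /= mxtrace_scalar dg; ring.
have sT : (size T <= 1)%N.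
  rewrite leqNgt; apply/negP => T1.
  have /(congr1 (fun q : {poly K} => (size q).-1)) := TD.
  rewrite mul_polyC size_comp_poly2; last first.
    by rewrite size_scale ?size_polyX // pnatr_eq0.
  have sT2 := size_exp T 2.
  rewrite size_polyDl ?sT2; first by case: (size T) T1 => [|[|s]] //= _; lia.
  rewrite size_polyN; apply: leq_ltn_trans (size_polyC_leq1 _) _.
  by rewrite -ltn_predRL sT2 muln_gt0 ltn_predRL T1.
have g0 : g 0 = 1%:M.
  have u0 : g 0 \in unitmx by rewrite unitmxE dg unitr1.
  have := gD 0 0; rewrite addr0 => /(congr1 (mulmx (invmx (g 0)))).
  by rewrite mulmxA mulVmx // mul1mx.
have [c Tc] : exists a, T = a%:P by exists T`_0; apply: size1_polyC.
move=> t; have := TE 0.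
by rewrite g0 mxtrace1 -TE Tc !hornerC.
Qed.

(** Trace 2 and determinant 1 give [(g 1 - 1)^2 = 0] by Cayley-Hamilton, so additivity yields
    [g n = 1 + n N] for natural [n]. Both sides are polynomial in the parameter, hence agree
    everywhere. *)
Lemma polynomial_group (K : numFieldType) (g : K -> 'M[K]_2)
    (p : 'M[{poly K}]_2) :
    (forall t i j, g t i j = (p i j).[t]) ->
    (forall s t, g (s + t) = g s *m g t) -> (forall t, \det (g t) = 1) ->
  exists2 N, N *m N = 0 & forall t, g t = 1%:M + t *: N.
Proof.
move=> gE gD dg; have tg := trace_polynomial_group gE gD dg.
pose N := g 1 - 1%:M; have g1 : g 1 = 1%:M + N by rewrite addrC subrK.
have NN : N *m N = 0.
  rewrite /N mulmxBl !mulmxBr !mulmx1 mul1mx cayley_hamilton2 tg dg.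
  by apply/matrixP=> i j; rewrite !mxE; ring.
clearbody N.
have gS (n : nat) : g n%:R = 1%:M + n%:R *: N.
  elim: n => [|n IHn]; last first.
    rewrite -natr1 gD IHn g1 mulmxDl !mulmxDr !mulmx1 mul1mx -scalemxAl NN.
    by rewrite scaler0 addr0 scalerDl scale1r addrAC addrA.
  have u1 : g 1 \in unitmx by rewrite unitmxE dg unitr1.
  have /(congr1 (mulmx^~ (invmx (g 1)))) := gD 0 1.
  by rewrite add0r -mulmxA mulmxV // mulmx1 scale0r addr0.
exists N => // t; apply/matrixP => i j.
suff pE : p i j = (1%:M : 'M[K]_2) i j *: 1 + N i j *: 'X.
  by rewrite gE pE !hornerE !mxE mulrC.
apply/subr0_eq/poly_natr_eq0 => n.
by rewrite !hornerE -gE gS !mxE; ring.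
Qed.

(** * Square-zero matrices and the braid relation *)

Lemma mulmx_nilp2 (F : fieldType) (M X : 'M[F]_2) :
  M *m M = 0 -> M *m X *m M = \tr (X *m M) *: M.
Proof.
move=> MM; have dM : \det M = 0.
  apply/eqP; rewrite -sqrf_eq0 expr2 -det_mulmx MM.
  by rewrite -(scale0r (0 : 'M_2)) detZ expr2 !mul0r.
(* Cayley-Hamilton for [X M] with one factor [X] cancelled; the explicit matrix is the adjugate of
   [X]. *)
suff -> : M *m X *m M = \tr (X *m M) *: M - 
    \det M *: mx2 (X 1 1) (- X 0 1) (- X 1 0) (X 0 0).
  by rewrite dM scale0r subr0.
by apply: eq_mx2; rewrite !mx2E /=; ring.
Qed.

(* As N M N = tr(M N) N, and symmetrically, the braid relation reduces to
   (1 - tr(M N)) (N + M) = 0. *)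
Lemma braid_nilp2 (F : fieldType) (N M : 'M[F]_2) :
    N *m N = 0 -> M *m M = 0 -> N + M != 0 ->
    (1%:M + N) *m (1%:M - M) *m (1%:M + N) =
    (1%:M - M) *m (1%:M + N) *m (1%:M - M) ->
  N *m M *m N = N /\ M *m N *m M = M.
Proof.
move=> NN MM nz.
have NMN := mulmx_nilp2 M NN; have MNM := mulmx_nilp2 N MM.
have e : \tr (N *m M) = \tr (M *m N) by rewrite mxtrace_mulC.
rewrite NMN MNM e; set z := \tr (M *m N) in NMN MNM e *.
rewrite !(mulmxDl, mulmxDr, mulmx1, mul1mx, mulmxN, mulNmx) NN MM NMN MNM e.
move/eqP; rewrite -subr_eq0 => /eqP h.
have : (1 - z) *: (N + M) = 0.
  by rewrite -h; apply/matrixP => i j; rewrite !mxE; ring.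
move/eqP; rewrite scaler_eq0 (negPf nz) orbF subr_eq0 => /eqP <-.
by rewrite !scale1r.
Qed.

Lemma upperE (R : comNzRingType) (t : R) : upper t = 1%:M + t *: delta_mx 0 1.
Proof. by apply: eq_mx2; rewrite !mx2E /=; ring. Qed.

Lemma lowerE (R : comNzRingType) (t : R) : lower t = 1%:M + t *: delta_mx 1 0.
Proof. by apply: eq_mx2; rewrite !mx2E /=; ring. Qed.

Lemma mul_delta_mid_delta (R : comNzRingType) m n p q (M : 'M[R]_(m, n))
    (k : 'I_p) (l : 'I_q) i j :
  delta_mx k i *m M *m delta_mx j l = M i j *: delta_mx k l.
Proof.
rewrite -(mul_delta_mx (0 : 'I_1) k i) -(mul_delta_mx (0 : 'I_1) j l).
rewrite -!mulmxA (mulmxA M) (mulmxA (delta_mx 0 i)) -colE -rowE.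
rewrite (mx11_scalar (row i _)) !mxE mul_scalar_mx -scalemxAr.
by rewrite mul_delta_mx.
Qed.

(** If [M e_j] is nonzero, then [N M e_j] and [M e_j] form a basis on which [N] and [M] act as the
    two matrix units; these are the columns of [P]. *)
Lemma nilp2_conj (F : fieldType) (N M : 'M[F]_2) :
    N != 0 -> N *m N = 0 -> M *m M = 0 -> N *m M *m N = N -> M *m N *m M = M ->
  exists B : GL2 F, N = invmx B *m delta_mx 0 1 *m B /\
                    M = invmx B *m delta_mx 1 0 *m B.
Proof.
move=> nzN NN MM NMN MNM.
have [[i j] /= nzM] : exists ij : 'I_2 * 'I_2, M ij.1 ij.2 != 0.
  apply/existsP; apply: contraNT nzN => /existsPn M0; rewrite -NMN.
  have -> : M = 0 by apply/matrixP => i j; rewrite mxE; apply/eqP/negPn/(M0 (i, j)).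
  by rewrite mulmx0 mul0mx.
pose P : 'M[F]_2 := N *m M *m delta_mx j 0 + M *m delta_mx j 1.
(* The rows of [C] are row [i] of [M] and of [M N]; up to the factor [M i j] this is the inverse of
   [P]. *)
pose C : 'M[F]_2 := delta_mx 0 i *m M + delta_mx 1 i *m (M *m N).
have NP : N *m P = P *m delta_mx 0 1.
  rewrite /P mulmxDr mulmxDl -!mulmxA mul_delta_mx mul_delta_mx_0 //.
  by rewrite !mulmxA NN !mul0mx add0r mulmx0 addr0.
have MP : M *m P = P *m delta_mx 1 0.
  rewrite /P mulmxDr mulmxDl -!mulmxA mul_delta_mx mul_delta_mx_0 //.
  by rewrite !mulmxA MM MNM !mul0mx !mulmx0 addr0 add0r.
have CP : C *m P = (M i j)%:M.
  rewrite /C /P mulmxDl !mulmxDr !mulmxA.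
  have MNMr (D : 'M_2) : D *m M *m N *m M = D *m M.
    by rewrite -!mulmxA (mulmxA M) MNM.
  rewrite !MNMr -(mulmxA _ M M) MM -(mulmxA _ N N) NN !mulmx0 !mul0mx.
  rewrite !mul_delta_mid_delta.
  by apply: eq_mx2; rewrite !mxE /=; ring.
have uP : P \in unitmx.
  have : ((M i j)^-1 *: C) *m P = 1%:M.
    by rewrite -scalemxAl CP scale_scalar_mx mulVf.
  by case/mulmx1_unit.
exists (MkGL2 uP)^-1%g; rewrite /= invmxK -NP -MP.
by rewrite -!mulmxA mulmxV // !mulmx1.
Qed.

(** * Automorphisms are conjugations by rational matrices *)

Lemma automorphism_line (f : SL2 algC -> SL2 algC) (U : algC -> SL2 algC)
    (V : 'M[algC]_2) :
    regular_morphism f -> {morph f : X Y / (X * Y)%g} ->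
    (forall s t, U (s + t) = (U s * U t)%g) ->
    (forall t, U t = 1%:M + t *: V :> 'M_2) ->
  exists2 N : 'M[algC]_2, N *m N = 0 & forall t, f (U t) = 1%:M + t *: N :> 'M_2.
Proof.
move=> [P fE] fM UD UE.
have /choice[q qE] (ij : 'I_2 * 'I_2) : exists q : {poly algC},
    forall t, f (U t) ij.1 ij.2 = q.[t].
  (* The entries of [f] are polynomials in those of its argument, and [U t] runs along the line
     through 1 with direction [V]. *)
  have [q qE] := meval_line (P ij.1 ij.2) (mxvec 1%:M 0) (mxvec V 0).
  exists q => t; rewrite fE -qE; apply: meval_eq => k.
  by rewrite UE linearD linearZ !mxE mulrC.
apply: (polynomial_group (g := fun t => f (U t)) (p := \matrix_(i, j) q (i, j))).
- by move=> t i j; rewrite mxE -qE.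
- by move=> s t; rewrite UD fM.
- by move=> t; apply/eqP/sl2_det.
Qed.

Lemma SL2Q_automorphism_Inn (f : SL2 algC -> SL2 algC) :
  SL2Q_automorphism f -> exists B : GL2 rat, f = Inn (gl2_ratr B).
Proof.
move=> [[fM fR [g [fK _ _]]] fQ].
have fI : injective f := can_inj fK.
have UE t : (sl2_upper t : SL2 algC) = 1%:M + t *: delta_mx 0 1 :> 'M_2.
  exact: upperE.
have LE t : (sl2_lower t : SL2 algC) = 1%:M + t *: delta_mx 1 0 :> 'M_2.
  exact: lowerE.
have [N' NN' fU] := automorphism_line fR fM (@sl2_upperD _) UE.
have [M' MM' fL] := automorphism_line fR fM (@sl2_lowerD _) LE.
have fQ1 X : exists Y : SL2 rat, f (sl2_ratr X) = sl2_ratr Y.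
  have : SL2Q (f (sl2_ratr X)) by rewrite -fQ; exists (sl2_ratr X) => //; exists X.
  by case=> Y _ <-; exists Y.
have ratrU : sl2_ratr (sl2_upper 1) = sl2_upper 1.
  by apply: val_inj; rewrite /= !upperE !scale1r map_mxD map_mx1 map_delta_mx.
have ratrL : sl2_ratr (sl2_lower 1) = sl2_lower 1.
  by apply: val_inj; rewrite /= !lowerE !scale1r map_mxD map_mx1 map_delta_mx.
(* Rationality is read off at [t = 1]: [N'] is [f(u(1)) - 1], and [f] maps [u(1)] to a rational
   matrix. *)
have [N NE] : exists N : 'M[rat]_2, N' = map_mx ratr N.
  have [Y] := fQ1 (sl2_upper 1); rewrite ratrU => /(congr1 val) /= YE.
  exists ((Y : 'M_2) - 1%:M); rewrite map_mxB map_mx1 -YE fU scale1r.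
  by rewrite addrC addKr.
have [M ME] : exists M : 'M[rat]_2, M' = map_mx ratr M.
  have [Y] := fQ1 (sl2_lower 1); rewrite ratrL => /(congr1 val) /= YE.
  exists ((Y : 'M_2) - 1%:M); rewrite map_mxB map_mx1 -YE fL scale1r.
  by rewrite addrC addKr.
have NN : N *m N = 0.
  by apply: (map_mx_inj (f := ratr : rat -> algC)); rewrite map_mxM -NE map_mx0.
have MM : M *m M = 0.
  by apply: (map_mx_inj (f := ratr : rat -> algC)); rewrite map_mxM -ME map_mx0.
(* By injectivity of [f]: [N = 0] would identify [u(1)] with [u(0)], and [N + M = 0] would identify
   [u(1)] with [l(-1)]. *)
have nzN : N != 0.
  apply/eqP => N0; have : sl2_upper 1 = sl2_upper 0 :> SL2 algC.
    by apply/fI/val_inj; rewrite /= !fU NE N0 map_mx0 !scaler0.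
  move/(congr1 (fun X : SL2 algC => X 0 1)); rewrite !mxE /= => /eqP.
  by rewrite oner_eq0.
have nzNM : N + M != 0.
  apply/eqP => NM0; have : sl2_upper 1 = sl2_lower (-1) :> SL2 algC.
    apply/fI/val_inj; rewrite /= fU fL NE ME scale1r scaleN1r -map_mxN.
    by congr (_ + map_mx _ _); apply/eqP; rewrite -addr_eq0 NM0.
  move/(congr1 (fun X : SL2 algC => X 0 1)); rewrite !mxE /= => /eqP.
  by rewrite oner_eq0.
have [NMN MNM] : N *m M *m N = N /\ M *m N *m M = M.
  apply: braid_nilp2 => //; apply: (map_mx_inj (f := ratr : rat -> algC)).
  have /(congr1 (fun X => f X : 'M_2)) := sl2_braid algC.
  rewrite !fM /= !fU !fL scale1r scaleN1r NE ME.
  by rewrite !(map_mxM, map_mxB, map_mxD, map_mx1).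
have [B [NB MB]] := nilp2_conj nzN NN MM NMN MNM.
have conjB t (Z E : 'M[rat]_2) : Z = invmx B *m E *m B ->
    1%:M + t *: map_mx ratr Z =
    invmx (gl2_ratr B) *m (1%:M + t *: map_mx ratr E) *m gl2_ratr B.
  move=> ->; rewrite !map_mxM map_invmx mulmxDr mulmxDl mulmx1 mulVmx ?gl2_unit //.
  by rewrite -scalemxAr -scalemxAl.
(* The rational [B] was built from [N] and [M] alone, so agreement holds on [u(t)] and [l(t)] for
   every algebraic [t], and these generate. *)
exists B; apply/funext; apply: SL2_elementary_ind => [X Y fX fY|t|t].
- rewrite fM fX fY; apply: val_inj => /=.
  by rewrite !mulmxA mulmxK ?(gl2_unit (gl2_ratr B)).
- by apply: val_inj; rewrite /= fU NE (conjB _ _ _ NB) map_delta_mx upperE.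
- by apply: val_inj; rewrite /= fL ME (conjB _ _ _ MB) map_delta_mx lowerE.
Qed.

(** * Conjugations: kernel, order and regularity *)

Section InnTheory.
Variable F : fieldType.
Implicit Types A B : GL2 F.

Lemma InnM A B : Inn (A * B)%g = Inn B \o Inn A.
Proof.
apply/funext => X; apply: val_inj => /=.
by have /= -> := congr1 (@gl2_mx F) (invgM A B); rewrite !mulmxA.
Qed.

Lemma gl2_expE A k : (A ^+ k)%g = (A : 'M_2) ^+ k :> 'M_2.
Proof. by elim: k => // k IHk; rewrite expgS exprS -IHk. Qed.

Lemma iter_Inn A k : iter k (Inn A) = Inn (A ^+ k)%g.
Proof.
elim: k => [|k IHk]; last by rewrite expgSr InnM -IHk.
by apply/funext => X; apply: val_inj; rewrite /= invmx1 mul1mx mulmx1.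
Qed.

Lemma scalar_mx2P (R : nzRingType) (A : 'M[R]_2) :
  A 0 1 = 0 -> A 1 0 = 0 -> A 0 0 = A 1 1 -> is_scalar_mx A.
Proof.
by move=> A01 A10 A00; apply/is_scalar_mxP; exists (A 1 1); apply: eq_mx2; rewrite !mxE.
Qed.

(** Commuting with [u(1)] and [l(1)] already kills the off-diagonal entries and equates the diagonal
    ones. *)
Lemma Inn_eq_id A : Inn A =1 id <-> is_scalar_mx A.
Proof.
split=> [A1 | /is_scalar_mxP[a Aa] X]; last first.
  apply: val_inj; rewrite /= -mulmxA {2}Aa scalar_mxC -Aa mulmxA.
  by rewrite mulVmx ?gl2_unit // mul1mx.
have AC (X : SL2 F) : A *m X = X *m A.
  by rewrite -[in LHS](A1 X) /= !mulmxA mulmxV ?gl2_unit // mul1mx.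
have /matrixP AU := AC (sl2_upper 1); have /matrixP AL := AC (sl2_lower 1).
have := AU 0 0; have := AU 0 1; have := AL 0 0; rewrite !mx2E /=.
rewrite !(mulr1, mulr0, mul1r, mul0r, addr0, add0r) => e1 e2 e3.
apply: scalar_mx2P; first by apply: (addrI (A 0 0)); rewrite addr0.
  by apply: (addrI (A 0 0)); rewrite addr0 -e3.
by apply: (addIr (A 0 1)); rewrite e2 addrC.
Qed.

Lemma Inn_eqP A B : Inn A = Inn B <-> exists c, A = c *: (B : 'M_2) :> 'M_2.
Proof.
have AB : A = (A * B^-1 * B)%g by rewrite -mulgA mulVg mulg1.
split=> [eAB | [c Ac]].
  have /Inn_eq_id/is_scalar_mxP[c /= ABc] : Inn (A * B^-1)%g =1 id.
    by rewrite InnM eAB => X /=; apply: InnK.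
  by exists c; rewrite AB /= ABc mul_scalar_mx.
rewrite AB InnM; apply/funext => X /=; congr (Inn B _); move: X.
apply/Inn_eq_id/is_scalar_mxP; exists c.
by rewrite /= Ac -scalemxAl mulmxV ?gl2_unit // scalemx1.
Qed.

End InnTheory.

Lemma gl2_ratrM A B : gl2_ratr (A * B)%g = (gl2_ratr A * gl2_ratr B)%g.
Proof. by apply: val_inj; rewrite /= map_mxM. Qed.

Lemma gl2_ratrV A : gl2_ratr A^-1%g = (gl2_ratr A)^-1%g.
Proof. by apply: val_inj; rewrite /= map_invmx. Qed.

Lemma gl2_ratrX A k : gl2_ratr (A ^+ k)%g = (gl2_ratr A ^+ k)%g.
Proof.
elim: k => [|k IHk]; last by rewrite !expgS gl2_ratrM IHk.
by apply: val_inj; rewrite /= map_mx1.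
Qed.

(** A priori the scalar is only algebraic; it is rational because it is the diagonal entry of the
    rational matrix [A *m invmx B]. *)
Lemma Inn_ratr_eqP (A B : GL2 rat) :
  Inn (gl2_ratr A) = Inn (gl2_ratr B) <-> exists c, A = c *: (B : 'M_2) :> 'M_2.
Proof.
rewrite Inn_eqP; split=> [[c /= AB]|[c AB]]; last first.
  by exists (ratr c); rewrite /= AB map_mxZ.
suff /is_scalar_mxP[d ABd] : is_scalar_mx (A *m invmx B).
  by exists d; rewrite -mul_scalar_mx -ABd mulmxKV ?gl2_unit.
rewrite -(map_mx_is_scalar (ratr : rat -> algC)) map_mxM AB -scalemxAl -map_mxM.
by rewrite mulmxV ?gl2_unit // map_mx1 scalemx1 scalar_mx_is_scalar.
Qed.

Lemma has_order_Inn m (A : GL2 rat) :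
  has_order m (Inn (gl2_ratr A)) <->
  [/\ (0 < m)%N, is_scalar_mx ((A : 'M_2) ^+ m) &
      forall k, (0 < k < m)%N -> ~~ is_scalar_mx ((A : 'M_2) ^+ k)].
Proof.
have iterE k : iter k (Inn (gl2_ratr A)) =1 id <-> is_scalar_mx ((A : 'M_2) ^+ k).
  by rewrite iter_Inn -gl2_ratrX Inn_eq_id /= map_mx_is_scalar gl2_expE.
split=> -[m0 /iterE Am minm]; split=> // k /minm.
  by move=> Ak; apply/negP => /iterE.
by move=> /negP Ak /iterE.
Qed.

Lemma regular_Inn (A : GL2 algC) : regular_morphism (Inn A).
Proof.
pose C : 'M[algC]_2 -> 'M[{mpoly algC[2 * 2]}]_2 := map_mx (@mpolyC _ _).
(* The generic matrix of coordinate functions. Evaluation at [Y] is a ring morphism that sends it to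
   [Y] and fixes constants, so it turns the generic conjugate into [Inn A Y]. *)
pose X : 'M[{mpoly algC[2 * 2]}]_2 := \matrix_(i, j) 'X_(mxvec_index i j).
exists (C (invmx A) *m X *m C A) => Y i j; set v := fun k => _.
have CK (B : 'M_2) : map_mx (meval v) (C B) = B.
  by apply/matrixP => k l; rewrite !mxE mevalC.
have XE : map_mx (meval v) X = Y.
  by apply/matrixP => k l; rewrite !mxE mevalXU /v mxvecE.
have /matrixP/(_ i j) : map_mx (meval v) (C (invmx A) *m X *m C A) = Inn A Y.
  by rewrite !map_mxM !CK XE.
by rewrite [LHS]mxE => <-.
Qed.

Lemma Inn_SL2Q_automorphism (A : GL2 rat) : SL2Q_automorphism (Inn (gl2_ratr A)).
Proof.
split; first split.
- by move=> X Y; apply: val_inj; rewrite /= !mulmxA mulmxK ?(gl2_unit (gl2_ratr A)).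
- exact: regular_Inn.
- exists (Inn (gl2_ratr A)^-1%g); split; [exact: InnK|exact: InnVK|exact: regular_Inn].
have InnE (B : GL2 rat) X : Inn (gl2_ratr B) (sl2_ratr X) = sl2_ratr (Inn B X).
  by apply: val_inj; rewrite /= !map_mxM map_invmx.
apply/seteqP; split=> [_ [_ [X _ <-] <-]|_ [X _ <-]].
  by exists (Inn A X).
exists (sl2_ratr (Inn A^-1%g X)); first by exists (Inn A^-1%g X).
by rewrite InnE InnVK.
Qed.

(** * Scalar powers of a nonscalar matrix *)

Section ScalarPowers.
Variables (F : fieldType) (A : 'M[F]_2).
Hypothesis nsA : ~~ is_scalar_mx A.
Local Notation t := (\tr A).
Local Notation d := (\det A).

(** By Cayley-Hamilton every power of [A] has this affine form, and [A] and 1 are linearly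
    independent; scalarity of a power thus becomes a polynomial condition on trace and
    determinant. *)
Lemma affine_is_scalar a b : is_scalar_mx (a *: A + b%:M) = (a == 0).
Proof.
apply/idP/eqP => [/is_scalar_mxP[c Ac] | ->]; last first.
  by rewrite scale0r add0r scalar_mx_is_scalar.
apply: contraNeq nsA => nza; apply/is_scalar_mxP; exists (a^-1 * (c - b)).
by rewrite -scale_scalar_mx raddfB /= -Ac addrK scalerA mulVf // scale1r.
Qed.

(** Multiplication in [F[A]], reduced by [A^2 = t A - d]. *)
Lemma affine_mul a b a' b' :
  (a *: A + b%:M) * (a' *: A + b'%:M) =
  (a * a' * t + a * b' + a' * b) *: A + (b * b' - a * a' * d)%:M.
Proof. by apply: eq_mx2; rewrite -[_ * _]/(_ *m _) !mx2E /=; ring. Qed.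

Lemma expmx2E : A ^+ 2 = t *: A + (- d)%:M.
Proof. by rewrite expr2 [LHS]cayley_hamilton2 raddfN. Qed.

Lemma expmx3E : A ^+ 3 = (t ^+ 2 - d) *: A + (- (t * d))%:M.
Proof.
rewrite exprS expmx2E -[A in A * _](addr0) -(raddf0 (@scalar_mx F 2)) -{1}[A]scale1r.
rewrite affine_mul; congr (_ *: _ + _%:M); ring.
Qed.

Lemma exp2_scalarE : is_scalar_mx (A ^+ 2) = (t == 0).
Proof. by rewrite expmx2E affine_is_scalar. Qed.

Lemma exp3_scalarE : is_scalar_mx (A ^+ 3) = (t ^+ 2 == d).
Proof. by rewrite expmx3E affine_is_scalar subr_eq0. Qed.

Lemma exp4_scalarE :
  is_scalar_mx (A ^+ 4) = (t == 0) || (t ^+ 2 == 2 * d).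
Proof.
rewrite (exprD A 2 2) expmx2E affine_mul affine_is_scalar.
have -> : t * t * t + t * - d + t * - d = t * (t ^+ 2 - 2 * d) by ring.
by rewrite mulf_eq0 subr_eq0.
Qed.

Lemma exp5_scalarE :
  is_scalar_mx (A ^+ 5) = (t ^+ 4 - 3 * t ^+ 2 * d + d ^+ 2 == 0).
Proof.
rewrite (exprD A 2 3) expmx2E expmx3E affine_mul affine_is_scalar.
by congr (_ == 0); ring.
Qed.

Lemma exp6_scalarE : is_scalar_mx (A ^+ 6) =
  [|| t == 0, t ^+ 2 == d | t ^+ 2 == 3 * d].
Proof.
rewrite (exprD A 3 3) expmx3E affine_mul affine_is_scalar.
have -> : (t ^+ 2 - d) * (t ^+ 2 - d) * t + (t ^+ 2 - d) * - (t * d) +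
    (t ^+ 2 - d) * - (t * d) = t * ((t ^+ 2 - d) * (t ^+ 2 - 3 * d)) by ring.
by rewrite !mulf_eq0 !subr_eq0.
Qed.

End ScalarPowers.

(** Here [l] and [u] are the eigenvalues of [B], so a scalar [B^m] equals both [l^m] and [u^m]. A
    double eigenvalue would give a nontrivial Jordan block, no power of which is scalar in
    characteristic zero. *)
Lemma scalar_power_eigenvalues (K : numFieldType) (B : 'M[K]_2) (l u : K) m :
    l + u = \tr B -> l * u = \det B -> \det B != 0 -> ~~ is_scalar_mx B ->
    (0 < m)%N -> is_scalar_mx (B ^+ m) ->
  l ^+ m = u ^+ m /\ l != u.
Proof.
move=> trB detB nzd nsB m0 /is_scalar_mxP[c Bc].
have nsBB a : B - a%:M != 0.
  by rewrite subr_eq0; apply: contraNneq nsB => ->; apply: scalar_mx_is_scalar.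
(* The columns of [B - v] are killed by [B - w], and they do not all vanish. *)
have eig v w : v + w = \tr B -> v * w = \det B -> c = w ^+ m.
  move=> tvw dvw; have BvB : B * (B - v%:M) = w *: (B - v%:M).
    rewrite mulrBr [B * B]cayley_hamilton2 -tvw -dvw [B * _]scalar_mxC.
    rewrite mul_scalar_mx scalerBr scale_scalar_mx scalerDl mulrC.
    by rewrite addrAC [v *: B + _]addrC addrK.
  have BvX k : B ^+ k * (B - v%:M) = w ^+ k *: (B - v%:M).
    elim: k => [|k IHk]; first by rewrite !expr0 mul1r scale1r.
    by rewrite exprS -mulrA IHk -scalerAr BvB scalerA -exprSr.
  have /eqP := BvX m; rewrite Bc [_ * _]mul_scalar_mx -subr_eq0 -scalerBl.
  by rewrite scaler_eq0 (negPf (nsBB v)) orbF subr_eq0 => /eqP.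
split.
  by rewrite -(eig _ _ trB detB); apply/esym/(eig u); rewrite 1?addrC 1?mulrC.
apply/eqP => lu.
have nzl : l != 0 by apply: contraNneq nzd => l0; rewrite -detB l0 mul0r.
pose N := B - l%:M.
(* For a double eigenvalue, the coefficient of [B] in [B^(k+1)] is [(k+1) l^k], which is nonzero. *)
have BX k : B ^+ k.+1 = (k.+1%:R * l ^+ k) *: B + (- (k%:R * l ^+ k.+1))%:M.
  elim: k => [|k IHk]; first by rewrite expr1 mul1r mul0r oppr0 scale1r raddf0 addr0.
  rewrite exprSr IHk -[in X in _ * X](addr0 B) -(raddf0 (@scalar_mx K 2)).
  rewrite -{2}[B]scale1r affine_mul -trB -detB -lu -![in RHS]natr1.
  rewrite -!natr1 !exprS; congr (_ *: _ + _%:M); ring.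
case: m m0 Bc {eig} => // m _ Bc.
have := affine_is_scalar nsB (m.+1%:R * l ^+ m) (- (m%:R * l ^+ m.+1)).
rewrite -BX Bc scalar_mx_is_scalar mulf_eq0 pnatr_eq0 expf_eq0 (negPf nzl) andbF.
by [].
Qed.

(* tr(A)^2 / det(A) = z + 1/z + 2 is a rational algebraic integer in [0, 4], and
   the value 4 would force z = 1, i.e., A scalar or of infinite order. *)
Lemma finite_order_trace (A : 'M[rat]_2) m :
    \det A != 0 -> ~~ is_scalar_mx A -> (0 < m)%N -> is_scalar_mx (A ^+ m) ->
  [|| \tr A == 0, \tr A ^+ 2 == \det A, \tr A ^+ 2 == 2 * \det A
    | \tr A ^+ 2 == 3 * \det A].
Proof.
move=> nzd nsA m0 Am; pose B : 'M[algC]_2 := map_mx ratr A.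
pose s := sqrtC (\tr B ^+ 2 - 4 * \det B).
have sE : s ^+ 2 = \tr B ^+ 2 - 4 * \det B by rewrite sqrtCK.
pose l := (\tr B + s) / 2; pose u := (\tr B - s) / 2.
have lDu : l + u = \tr B by rewrite /l /u; field.
have lMu : l * u = \det B.
  have -> : \det B = (\tr B ^+ 2 - s ^+ 2) / 4 by rewrite sE; field.
  by rewrite /l /u; field.
have dB : \det B = ratr (\det A) by rewrite det_map_mx.
have nzdB : \det B != 0 by rewrite dB fmorph_eq0.
have [lu neq_lu] : l ^+ m = u ^+ m /\ l != u.
  apply: scalar_power_eigenvalues (lDu) lMu nzdB _ m0 _.
    by rewrite map_mx_is_scalar.
  by rewrite /B -rmorphXn map_mx_is_scalar.
clearbody l u.
have [nzl nzu] : l != 0 /\ u != 0.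
  by apply/andP; rewrite -negb_or -mulf_eq0 lMu.
pose z := l / u; have zm : z ^+ m = 1.
  by rewrite expr_div_n lu divff // expf_neq0.
have nzz : z != 0 by rewrite mulf_neq0 ?invr_eq0.
have zE : ratr (\tr A ^+ 2 / \det A) = z + z^-1 + 2.
  rewrite fmorph_div rmorphXn -det_map_mx -trace_map_mx -/B -lDu -lMu /z.
  by field; rewrite nzl nzu.
have Aintz (x : algC) : x ^+ m = 1 -> x \in Aint.
  by move=> xm; apply: (Aint_unity_root m0); apply/unity_rootP.
have /Cint_rat_Aint : ratr (\tr A ^+ 2 / \det A) \in Crat by apply: Crat_rat.
rewrite zE => /(_ _)/intrP[|k kE].
  apply: rpredD; last exact: (rpred_nat _ 2).
  by apply: rpredD; apply: Aintz; rewrite ?exprVn zm ?invr1.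
have nz1 (x : algC) : x ^+ m = 1 -> `|x| = 1.
  by move=> xm; apply/eqP; rewrite -(pexpr_eq1 m0) // -normrX xm normr1.
have zle2 : `|z + z^-1| <= 2.
  rewrite (le_trans (ler_normD _ _)) // !nz1 ?exprVn ?zm ?invr1 //.
have kz : z + z^-1 = (k - 2)%:~R by rewrite intrB -kE addrK.
have k04 : 0 <= k <= 4.
  have : `|k - 2| <= 2 by rewrite -(ler_int algC) intr_norm -kz.
  lia.
have k4 : k != 4.
  apply: contra neq_lu => /eqP k4.
  have : (z - 1) ^+ 2 = 0.
    have -> : (z - 1) ^+ 2 = z * (z + z^-1 - 2) by field.
    by rewrite kz k4 subrr mulr0.
  move/eqP; rewrite sqrf_eq0 subr_eq0 => /eqP z1.
  by rewrite -(divfK nzu l) -/z z1 mul1r.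
have trE : \tr A ^+ 2 = k%:~R * \det A.
  suff <- : \tr A ^+ 2 / \det A = k%:~R by rewrite divfK.
  by apply: (fmorph_inj (ratr : rat -> algC)); rewrite /= ratr_int -kE -zE.
have : k \in [:: 0; 1; 2; 3] by case: k k04 k4 {kz kE trE} => [[|[|[|[|[|]]]]]|].
rewrite !inE -[\tr A == 0]sqrf_eq0 trE => /or4P[] /eqP ->.
- by rewrite mul0r eqxx.
- by rewrite mul1r eqxx orbT.
- by rewrite eqxx !orbT.
- by rewrite eqxx !orbT.
Qed.

(** * Orders of conjugations in terms of trace and determinant *)

Lemma has_order_uniq m n f : has_order m f -> has_order n f -> m = n.
Proof.
move=> [m0 fm minm] [n0 fn minn].
case: (ltngtP m n) => // [mn|nm]; first by case: (minn m); rewrite ?m0.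
by case: (minm n); rewrite ?n0.
Qed.

Section OrderTrace.
Variable A : GL2 rat.
Local Notation t := (\tr A).
Local Notation d := (\det A).

Lemma gl2_det_neq0 : d != 0.
Proof. by rewrite -unitfE -unitmxE gl2_unit. Qed.

Lemma has_order2_Inn :
  has_order 2 (Inn (gl2_ratr A)) <-> ~~ is_scalar_mx A && (t == 0).
Proof.
rewrite has_order_Inn; split=> [[_ A2 minA]|/andP[nsA t0]].
  by have nsA := minA 1 isT; rewrite expr1 in nsA; rewrite nsA -exp2_scalarE.
by split=> // [|[|[]]] //; rewrite exp2_scalarE.
Qed.

Lemma has_order3_Inn :
  has_order 3 (Inn (gl2_ratr A)) <-> ~~ is_scalar_mx A && (t ^+ 2 == d).
Proof.
have nzd := gl2_det_neq0.
rewrite has_order_Inn; split=> [[_ A3 minA]|/andP[nsA td]].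
  by have nsA := minA 1 isT; rewrite expr1 in nsA; rewrite nsA -exp3_scalarE.
split=> // [|[|[|[]]]] // => [|_]; first by rewrite exp3_scalarE.
by rewrite exp2_scalarE // -sqrf_eq0 (eqP td).
Qed.

(** The condition [t = 0] for a scalar fourth power comes from the square, so minimality removes it.
    Conversely, as [d != 0], distinct values of [t^2 / d] exclude one another. Order 6 is treated
    alike. *)
Lemma has_order4_Inn :
  has_order 4 (Inn (gl2_ratr A)) <-> ~~ is_scalar_mx A && (t ^+ 2 == 2 * d).
Proof.
have nzd := gl2_det_neq0.
rewrite has_order_Inn; split=> [[_ A4 minA]|/andP[nsA td]].
  have nsA := minA 1 isT; rewrite expr1 in nsA; have := minA 2 isT.
  by rewrite nsA exp2_scalarE // => /negPf t0; move: A4; rewrite exp4_scalarE // t0.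
have nzt : t != 0 by rewrite -sqrf_eq0 (eqP td) mulf_neq0.
split=> // [|[|[|[|[]]]]] // => [|_|_].
- by rewrite exp4_scalarE // td orbT.
- by rewrite exp2_scalarE.
- rewrite exp3_scalarE // (eqP td) -subr_eq0.
  by have -> : 2 * d - d = d by ring.
Qed.

Lemma has_order6_Inn :
  has_order 6 (Inn (gl2_ratr A)) <-> ~~ is_scalar_mx A && (t ^+ 2 == 3 * d).
Proof.
have nzd := gl2_det_neq0.
rewrite has_order_Inn; split=> [[_ A6 minA]|/andP[nsA td]].
  have nsA := minA 1 isT; rewrite expr1 in nsA.
  have := minA 2 isT; have := minA 3 isT.
  rewrite nsA exp2_scalarE // exp3_scalarE // => /negPf td /negPf t0.
  by move: A6; rewrite exp6_scalarE // t0 td.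
have nzt : t != 0 by rewrite -sqrf_eq0 (eqP td) mulf_neq0.
split=> // [|[|[|[|[|[|[]]]]]]] // => [|_|_|_|_].
- by rewrite exp6_scalarE // td !orbT.
- by rewrite exp2_scalarE.
- rewrite exp3_scalarE // (eqP td) -subr_eq0.
  have -> : 3 * d - d = 2 * d by ring.
  by rewrite mulf_neq0.
- rewrite exp4_scalarE // (negPf nzt) (eqP td) -subr_eq0 /=.
  by have -> : 3 * d - 2 * d = d by ring.
- rewrite exp5_scalarE // (exprM _ 2 2) (eqP td).
  have -> : (3 * d) ^+ 2 - 3 * (3 * d) * d + d ^+ 2 = d ^+ 2 by ring.
  by rewrite expf_eq0.
Qed.

End OrderTrace.

(** A scalar [A] induces the identity; otherwise each of the four trace conditions exhibits one of
    the orders 2, 3, 4, 6, and the order is unique. *)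
Lemma finite_order_Inn m (A : GL2 rat) :
  has_order m (Inn (gl2_ratr A)) -> m \in [:: 1; 2; 3; 4; 6]%N.
Proof.
move=> mA; have [m0 Am minA] := (has_order_Inn m A).1 mA.
have [sA|nsA] := boolP (is_scalar_mx A).
  suff -> : m = 1%N by [].
  case: m m0 minA {mA Am} => [|[|m]] // _ /(_ 1%N isT).
  by rewrite expr1 sA.
have m_eq n : has_order n (Inn (gl2_ratr A)) -> m = n := has_order_uniq mA.
case/or4P: (finite_order_trace (gl2_det_neq0 A) nsA m0 Am) => tA.
- by rewrite (m_eq 2%N) //; apply/has_order2_Inn; rewrite nsA.
- by rewrite (m_eq 3%N) //; apply/has_order3_Inn; rewrite nsA.
- by rewrite (m_eq 4%N) //; apply/has_order4_Inn; rewrite nsA.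
- by rewrite (m_eq 6%N) //; apply/has_order6_Inn; rewrite nsA.
Qed.

(** * Companion matrices and rational conjugacy *)

Section Companion.
Variable F : fieldType.
Implicit Types (t d : F).

Definition companion t d : 'M[F]_2 := mx2 0 (- d) 1 t.

Lemma tr_companion t d : \tr (companion t d) = t.
Proof. by rewrite !mx2E /= add0r. Qed.

Lemma det_companion t d : \det (companion t d) = d.
Proof. by rewrite !mx2E /=; ring. Qed.

Lemma companion_unit t d : d != 0 -> companion t d \in unitmx.
Proof. by rewrite unitmxE det_companion unitfE. Qed.

Lemma companion_nonscalar t d : ~~ is_scalar_mx (companion t d).
Proof.
apply/is_scalar_mxP => -[c /matrixP/(_ 1 0)]; rewrite !mxE /= => /eqP.
by rewrite oner_eq0.
Qed.

(** A nonscalar matrix has a cyclic vector [v], and the columns [v], [A v] of [Q] satisfy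
    [A (A v) = t A v - d v]. *)
Lemma conj_companion (A : 'M[F]_2) : ~~ is_scalar_mx A ->
  exists Q : GL2 F, A *m Q = Q *m companion (\tr A) (\det A).
Proof.
move=> nsA; pose Q x y := mx2 x (A 0 0 * x + A 0 1 * y) y (A 1 0 * x + A 1 1 * y).
have AQ x y : A *m Q x y = Q x y *m companion (\tr A) (\det A).
  by apply: eq_mx2; rewrite !mx2E /=; ring.
suff [x [y uQ]] : exists x, exists y, Q x y \in unitmx 
  by exists (MkGL2 uQ); apply: AQ.
have detQ x y : \det (Q x y) =
    x * (A 1 0 * x + A 1 1 * y) - (A 0 0 * x + A 0 1 * y) * y.
  by rewrite !mx2E /=; ring.
have uQ x y : (Q x y \in unitmx) = (\det (Q x y) != 0) by rewrite unitmxE unitfE.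
(* The cyclic vector is [e_0], [e_1] or, for a diagonal matrix with distinct entries,
   [e_0 + e_1]. *)
have [A10|A10] := eqVneq (A 1 0) 0; last first.
  by exists 1, 0; rewrite uQ detQ !(mulr1, mulr0, mul1r, addr0, subr0).
have [A01|A01] := eqVneq (A 0 1) 0; last first.
  exists 0, 1; rewrite uQ detQ.
  by rewrite !(mulr1, mulr0, mul0r, add0r, sub0r) oppr_eq0.
exists 1, 1; rewrite uQ detQ A10 A01 !mulr1 add0r addr0 mul1r subr_eq0.
by apply: contraNneq nsA => A11; apply: scalar_mx2P.
Qed.

Lemma conj_of_tr_det (A B : GL2 F) :
    ~~ is_scalar_mx A -> ~~ is_scalar_mx B -> \tr A = \tr B -> \det A = \det B ->
  exists Q : GL2 F, (Q * A * Q^-1)%g = B.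
Proof.
move=> nsA nsB trAB detAB.
have [P AP] := conj_companion nsA; have [Q BQ] := conj_companion nsB.
pose C : GL2 F := (P^-1 * A * P)%g.
have CE : companion (\tr A) (\det A) = C.
  by rewrite /C /= -mulmxA AP mulmxA mulVmx ?gl2_unit // mul1mx.
have BE : (B * Q = Q * C)%g by apply: val_inj; rewrite /= BQ -trAB -detAB CE.
exists (Q * P^-1)%g.
transitivity (Q * C * Q^-1)%g; first by rewrite /C invgM invgK !mulgA.
by rewrite -BE -mulgA mulgV mulg1.
Qed.

End Companion.

(** * Isomorphy classes, and their uniqueness for nonzero trace *)

Lemma isomorphic_refl theta : isomorphic_over_GL2Q theta theta.
Proof.
exists 1%g; apply/funext => X; rewrite /= -gl2_ratrV invg1.
have Inn1 : Inn (gl2_ratr 1%g) =1 id.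
  by apply/Inn_eq_id; rewrite /= map_mx1 scalar_mx_is_scalar.
by rewrite !Inn1.
Qed.

Lemma isomorphic_sym theta tau :
  isomorphic_over_GL2Q theta tau -> isomorphic_over_GL2Q tau theta.
Proof.
case=> Q ->; exists Q^-1%g; apply/funext => X.
by rewrite /= gl2_ratrV invgK !InnVK.
Qed.

Lemma isomorphic_trans theta tau sigma :
  isomorphic_over_GL2Q theta tau -> isomorphic_over_GL2Q tau sigma ->
  isomorphic_over_GL2Q theta sigma.
Proof.
case=> Q -> [P ->]; exists (P * Q)%g.
by rewrite gl2_ratrM invgM !InnM.
Qed.

Lemma isomorphy_class_eq theta tau : SL2Q_automorphism tau ->
  isomorphy_class theta = isomorphy_class tau <-> isomorphic_over_GL2Q theta tau.
Proof.
move=> tauQ; split=> [eqc | thetatau].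
  have : isomorphy_class tau tau by split=> //; apply: isomorphic_refl.
  by rewrite -eqc => -[].
apply/seteqP; split=> sigma [sigmaQ sigmaI]; split=> //.
  exact: isomorphic_trans (isomorphic_sym thetatau) sigmaI.
exact: isomorphic_trans thetatau sigmaI.
Qed.

(** [Inn] reverses products, whence [Q A Q^-1] and not [Q^-1 A Q]. *)
Lemma isomorphic_InnP (A : GL2 rat) tau :
  isomorphic_over_GL2Q (Inn (gl2_ratr A)) tau <->
  exists Q : GL2 rat, tau = Inn (gl2_ratr (Q * A * Q^-1)%g).
Proof.
by split=> -[Q ->]; exists Q; rewrite !gl2_ratrM gl2_ratrV !InnM.
Qed.

Definition gl2_companion t d (nzd : d != 0) : GL2 rat :=
  MkGL2 (companion_unit t nzd).

(* Rescaling B, which does not change Inn_B, makes the traces, hence the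
   determinants, equal. *)
Lemma isomorphic_of_tr_det (r : rat) (A B : GL2 rat) : r != 0 ->
    ~~ is_scalar_mx A && (\tr A ^+ 2 == r * \det A) ->
    ~~ is_scalar_mx B && (\tr B ^+ 2 == r * \det B) ->
  isomorphic_over_GL2Q (Inn (gl2_ratr A)) (Inn (gl2_ratr B)).
Proof.
move=> nzr /andP[nsA /eqP trA] /andP[nsB /eqP trB].
(* This is where [r != 0] enters: the traces are nonzero, so their quotient can serve as the
   rescaling factor. *)
have nzt (C : GL2 rat) : \tr C ^+ 2 = r * \det C -> \tr C != 0.
  by move=> trC; rewrite -sqrf_eq0 trC mulf_neq0 ?gl2_det_neq0.
have [nztA nztB] := (nzt A trA, nzt B trB).
pose c := \tr A / \tr B; have nzc : c != 0 by rewrite mulf_neq0 ?invr_eq0.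
have ucB : c *: (B : 'M_2) \in unitmx.
  by rewrite unitmxE detZ unitfE mulf_neq0 ?expf_neq0 ?gl2_det_neq0.
have -> : Inn (gl2_ratr B) = Inn (gl2_ratr (MkGL2 ucB)).
  by apply/esym/Inn_ratr_eqP; exists c.
have [|||Q QA] := conj_of_tr_det (A := A) (B := MkGL2 ucB) nsA; rewrite /=.
- apply: contra nsB => /is_scalar_mxP[a cB]; apply/is_scalar_mxP; exists (c^-1 * a).
  by rewrite -scale_scalar_mx -cB scalerA mulVf // scale1r.
- by rewrite linearZ /= divfK.
- apply: (mulfI nzr); rewrite -trA detZ mulrCA -trB.
  by rewrite -exprMn divfK.
by apply/isomorphic_InnP; exists Q; rewrite QA.
Qed.

Lemma isomorphy_classes_card1 m (r : rat) : r != 0 ->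
    (forall A : GL2 rat, has_order m (Inn (gl2_ratr A)) <->
       ~~ is_scalar_mx A && (\tr A ^+ 2 == r * \det A)) ->
  (isomorphy_classes m #= `I_1)%card.
Proof.
move=> nzr ordA; pose C := gl2_companion r nzr.
(* Trace and determinant of [C] are both [r], so that [t^2 = r d]. *)
have ordC : has_order m (Inn (gl2_ratr C)).
  by apply/ordA; rewrite companion_nonscalar tr_companion det_companion expr2 /=.
suff -> : isomorphy_classes m = [set isomorphy_class (Inn (gl2_ratr C))]%classic.
  exact: card_set1.
have CQ := Inn_SL2Q_automorphism C.
apply/seteqP; split=> [_ [theta [thetaQ ord_theta] <-] | _ ->].
  have [A thetaA] := SL2Q_automorphism_Inn thetaQ.
  apply/isomorphy_class_eq => //; rewrite thetaA in ord_theta *.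
  by apply: (isomorphic_of_tr_det nzr); apply/ordA.
by exists (Inn (gl2_ratr C)).
Qed.

(** * Infinitely many classes of involutions *)

Lemma eq_prime_mod_square (p q : nat) (c : rat) :
  prime p -> prime q -> p%:R = c ^+ 2 * q%:R -> p = q.
Proof.
move=> p_pr q_pr; rewrite -(divq_num_den c) expr_div_n.
set a := numq c; set b := denq c => pq.
have nzb : b != 0 by apply: denq_neq0.
have {}pq : p%:R * b ^+ 2 = a ^+ 2 * q%:R :> int.
  apply: (@intr_inj rat); rewrite [LHS]intrM [RHS]intrM !rmorphXn /=.
  rewrite !rmorph_nat pq mulrAC divfK //.
  by rewrite expf_neq0 // intr_eq0.
have {}pq : (p * `|b| ^ 2 = `|a| ^ 2 * q)%N.
  by have := congr1 absz pq; rewrite [LHS]abszM [RHS]abszM !abszX !natz !absz_nat.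
have b0 : (0 < `|b|)%N by rewrite absz_gt0.
have a0 : (0 < `|a|)%N.
  have : (0 < p * `|b| ^ 2)%N by rewrite muln_gt0 prime_gt0 // expn_gt0 b0.
  by rewrite pq muln_gt0 expn_gt0 orbF => /andP[].
(* The valuation at [p] of [p b^2] is odd, whereas that of [a^2 q] is even if [q] differs from
   [p]. *)
have := congr1 (logn p) pq.
rewrite (lognM p (prime_gt0 p_pr)) ?expn_gt0 ?b0 //.
rewrite (lognM p _ (prime_gt0 q_pr)) ?expn_gt0 ?a0 // !lognX.
rewrite (logn_prime p p_pr) (logn_prime p q_pr).
by rewrite eqxx; case: eqVneq => //= _; lia.
Qed.

Lemma infinite_primes : infinite_set [set p | prime p]%classic.
Proof.
move=> /finite_seqP[s sE]; have [p sp p_pr] := prime_above (\max_(q <- s) q).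
have : [set p | prime p]%classic p by [].
rewrite sE /= => ps; move: sp; rewrite ltnNge => /negP; apply.
exact: leq_bigmax_seq.
Qed.

Lemma infinite_involution_classes : infinite_set (isomorphy_classes 2).
Proof.
have nzS (n : nat) : n.+1%:R != 0 :> rat by rewrite pnatr_eq0.
(* Trace 0 and determinant [n.-1.+1]: nonzero for every [n], and equal to [n] when [n] is prime. *)
pose C (n : nat) := gl2_companion 0 (nzS n.-1).
pose cl n := isomorphy_class (Inn (gl2_ratr (C n))).
have cl_inj : {in [set p | prime p]%classic &, injective cl}.
  move=> p q /set_mem/= p_pr /set_mem/= q_pr /isomorphy_class_eq.
  move=> /(_ (Inn_SL2Q_automorphism _))/isomorphic_InnP[Q].
  (* Conjugation preserves the determinant and the scalar [c] multiplies it by [c^2], so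
     [p = c^2 q]. *)
  move=> /esym/Inn_ratr_eqP[c /(congr1 (@determinant _ _))] /=.
  rewrite detZ !det_mulmx det_inv mulrAC mulfV ?gl2_det_neq0 // mul1r.
  by rewrite !det_companion !prednK ?prime_gt0 //; apply: eq_prime_mod_square.
have sub : (cl @` [set p | prime p] `<=` isomorphy_classes 2)%classic.
  move=> _ [p _ <-]; exists (Inn (gl2_ratr (C p))) => //.
  split; first exact: Inn_SL2Q_automorphism.
  by apply/has_order2_Inn; rewrite companion_nonscalar tr_companion /=.
apply: sub_infinite_set sub _ => fin; apply: infinite_primes.
by rewrite -(eq_finite_set (inj_card_eq cl_inj)).
Qed.

End Automorphisms.

Theorem theorem7p7 :
  (forall m : nat,
     (exists theta : SL2 algC -> SL2 algC,
        SL2Q_automorphism theta /\ has_order m theta)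
     <-> m \in [:: 1; 2; 3; 4; 6]) /\
  infinite_set (isomorphy_classes 2) /\
  (isomorphy_classes 3 #= `I_1)%card /\
  (isomorphy_classes 4 #= `I_1)%card /\
  (isomorphy_classes 6 #= `I_1)%card.
Proof.
have ord3 (A : GL2 rat) : has_order 3 (Inn (gl2_ratr A)) <->
    ~~ is_scalar_mx A && (\tr A ^+ 2 == 1 * \det A)%R.
  by rewrite GRing.mul1r; apply: has_order3_Inn.
have nz2 : (2 != 0 :> rat)%R by [].
have nz1 : (1 != 0 :> rat)%R by [].
have nz3 : (3 != 0 :> rat)%R by [].
split; last split; last split; last split; last first.
- exact: isomorphy_classes_card1 nz3 has_order6_Inn.
- exact: isomorphy_classes_card1 nz2 has_order4_Inn.
- exact: isomorphy_classes_card1 nz1 ord3.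
- exact: infinite_involution_classes.
move=> m; split=> [[theta [/SL2Q_automorphism_Inn[A ->] mA]]|].
  exact: finite_order_Inn mA.
have aut (A : GL2 rat) k : has_order k (Inn (gl2_ratr A)) ->
    exists theta, SL2Q_automorphism theta /\ has_order k theta.
  by exists (Inn (gl2_ratr A)); split=> //; apply: Inn_SL2Q_automorphism.
(* Witnesses: the identity, then companion matrices with trace and determinant (0, 1), (1, 1), (2,
   2), (3, 3), for which [t^2 / d] is 0, 1, 2, 3. *)
rewrite !inE => /or4P[/eqP->|/eqP->|/eqP->|/orP[]/eqP->].
- apply: (aut 1%g); apply/has_order_Inn; split=> //; first exact: scalar_mx_is_scalar.
  by case=> [|k] /andP[].
- apply: (aut (gl2_companion 0%R nz1)); apply/has_order2_Inn.
  by rewrite companion_nonscalar tr_companion.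
- apply: (aut (gl2_companion 1%R nz1)); apply/ord3.
  by rewrite companion_nonscalar tr_companion det_companion.
- apply: (aut (gl2_companion 2%R nz2)); apply/has_order4_Inn.
  by rewrite companion_nonscalar tr_companion det_companion.
- apply: (aut (gl2_companion 3%R nz3)); apply/has_order6_Inn.
  by rewrite companion_nonscalar tr_companion det_companion.
Qed.
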